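(* Let $G=\bigcap_{i\in\mathcal I}G_i\subset\mathbb R^d$ and vector fields $\gamma^i$, $i\in\mathcal I=\{1,\dots,\mathbf I\}$, satisfy assumptions (A1)–(A5) described in the context, with constants $a\in(0,1)$, $L>0$, function $R(\cdot)$ from (A2) and function $D(\cdot)$ from (A3), and let $\rho_0=\frac{a}{4L}$. There exists a nondecreasing function $\Pi:(0,\infty)\to(0,\infty]$ with $\Pi(u)\to0$ as $u\to0$, depending only on $\mathbf I$, $a$ and the function $D(\cdot)$, such that the following holds. Whenever $0<\rho<\min\{\frac{\rho_0}{4},\frac{R(a/4)}{4}\}$, $0<\delta<\frac{\rho}{2}$, $0\le s<t<\infty$, and $w,x\in D([s,t],\mathbb R^d)$, $y=(y_1,\dots,y_{\mathbf I})\in D([s,t],\mathbb R^{\mathbf I})$ satisfy (i) there is $x_0\in\overline G$ such that $w(u)\in B_\rho(x_0)\cap U_\delta(G)$ for all $u\in[s,t]$; (ii) $w(u)=w(s)+x(u)-x(s)+\sum_{i\in\mathcal I}\int_{(s,u]}\gamma^i(w(v))\,dy_i(v)$ for all $u\in[s,t]$; (iii) for each $i\in\mathcal I$: (a) $y_i(s)\ge0$; (b) $y_i$ is nondecreasing and $\Delta y_i(u)=y_i(u)-y_i(u-)\le\delta$ for all $u\in(s,t]$; (c) $y_i(u)=y_i(s)+\int_{(s,u]}1_{\{w(v)\in U_\delta(\partial G_i\cap\partial G)\}}\,dy_i(v)$ for all $u\in[s,t]$; (iv) $D\big(\Pi(\mathrm{Osc}(x,[s,t])+\delta)\big)<\frac{\rho}{2}$,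 then $$\mathrm{Osc}(w,[s,t])\le\Pi(\mathrm{Osc}(x,[s,t])+\delta)\quad\text{and}\quad \mathrm{Osc}(y,[s,t])\le\Pi(\mathrm{Osc}(x,[s,t])+\delta).$$
   Context: Notation: $\|\cdot\|$ is the Euclidean norm, $\langle\cdot,\cdot\rangle$ the inner product. $\mathrm{dist}(x,S)=\inf\{\|x-y\|:y\in S\}$, with $\mathrm{dist}(x,\emptyset)=\infty$. For $r>0$, $U_r(S)=\{x\in\mathbb R^d:\mathrm{dist}(x,S)\le r\}$ (and $U_r(\emptyset)=\emptyset$); $B_r(x)$ is the closed ball of radius $r$ about $x$. For $0\le t_1<t_2<\infty$, $D([t_1,t_2],\mathbb R^k)$ is the set of functions $[t_1,t_2]\to\mathbb R^k$ that are right continuous with finite left limits, and for such $w$, $\mathrm{Osc}(w,[t_1,t_2])=\sup\{\|w(t)-w(s)\|:t_1\le s<t\le t_2\}$. A domain is an open connected set. The boundary of a nonempty domain $S$ is $C^1$ if for each $x\in\partial S$ there are a Euclidean coordinate system centered at $x$, $r_x>0$ and a $C^1$ function $\varphi_x:\mathbb R^{d-1}\to\mathbb R$ with $\varphi_x(0)=0$ such that $S\cap B_{r_x}(x)=\{z:z_d>\varphi_x(z_1,\dots,z_{d-1})\}\cap B_{r_x}(x)$; the inward unit normal is then defined in the usual way. For $x\in\mathbb R^d$ let $\mathcal I(x)=\{i\in\mathcal I:x\in\partial G_i\}$. (A1) $G$ is a nonempty domain in $\mathbb R^d$ with $G=\bigcap_{i\in\mathcal I}G_i$, where each $G_i$ is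 a nonempty domain, $G_i\ne\mathbb R^d$, with $C^1$ boundary; $n^i(\cdot)$ denotes the unit normal on $\partial G_i$ pointing into $G_i$. (A2) For each $\varepsilon\in(0,1)$ there is $R(\varepsilon)>0$ such that for each $i\in\mathcal I$, $x\in\partial G_i\cap\partial G$ and $y\in\overline G$ with $\|x-y\|<R(\varepsilon)$: $\langle n^i(x),y-x\rangle\ge-\varepsilon\|x-y\|$. (A3) The function $D:[0,\infty)\to[0,\infty]$ defined by $D(0)=0$ and, for $r>0$, $D(r)=\sup_{\emptyset\ne\mathcal J\subset\mathcal I}\sup\{\mathrm{dist}(x,\bigcap_{j\in\mathcal J}(\partial G_j\cap\partial G)):x\in\bigcap_{j\in\mathcal J}U_r(\partial G_j\cap\partial G)\}$ (supremum over an empty set being $0$) satisfies $D(r)\to0$ as $r\to0$. By convention $D(\infty)=\infty$. (A4) There is $L>0$ such that each $\gamma^i:\mathbb R^d\to\mathbb R^d$ is uniformly Lipschitz with constant $L$ and $\|\gamma^i(x)\|=1$ for all $x$. (A5) There are $a\in(0,1)$ and functions $b,c:\partial G\to\mathbb R_+^{\mathbf I}$ such that for each $x\in\partial G$: $\sum_{i\in\mathcal I(x)}b_i(x)=1$ and $\min_{j\in\mathcal I(x)}\langle\sum_{i\in\mathcal I(x)}b_i(x)n^i(x),\gamma^j(x)\rangle\ge a$; and $\sum_{i\in\mathcal I(x)}c_i(x)=1$ and $\min_{j\in\mathcal I(x)}\langle\sum_{i\in\mathcal I(x)}c_i(x)\gamma^i(x),n^j(x)\rangle\ge a$. *)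

(* Defs.v *)
From HB Require Import structures.
From mathcomp Require Import all_boot all_order all_algebra.
From mathcomp Require Import all_classical all_reals all_analysis.
Set Implicit Arguments. Unset Strict Implicit. Unset Printing Implicit Defensive.
Import Order.TTheory GRing.Theory Num.Theory numFieldNormedType.Exports.
Local Open Scope classical_set_scope.
Local Open Scope ring_scope.

Section Defs.
Variable R : realType.

Definition dotp (d : nat) (u v : 'rV[R]_d) : R := \sum_(k < d) u 0 k * v 0 k.
Definition enorm (d : nat) (v : 'rV[R]_d) : R := Num.sqrt (\sum_(k < d) v 0 k ^+ 2).

(* dist(x,S) = inf{|x-y| : y in S}, with dist(x, empty) = +oo *)
Definition edist (d : nat) (x : 'rV[R]_d) (S : set 'rV[R]_d) : \bar R :=
  ereal_inf [set (enorm (x - y))%:E | y in S].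

(* U_r(S) = {x : dist(x,S) <= r}  (so U_r(empty) = empty) *)
Definition Unbhd (d : nat) (r : R) (S : set 'rV[R]_d) : set 'rV[R]_d :=
  [set x | (edist x S <= r%:E)%E].

Definition cball (d : nat) (x : 'rV[R]_d) (r : R) : set 'rV[R]_d :=
  [set z | enorm (z - x) <= r].

Definition bd (d : nat) (S : set 'rV[R]_d) : set 'rV[R]_d :=
  closure S `\` interior S.

Definition domain (d : nat) (S : set 'rV[R]_d) : Prop := open S /\ connected S.

(* Euclidean coordinate systems: coordinates of z centered at x are (z - x) *m Q
   with Q orthogonal; the distinguished (d-th) coordinate is the last one. *)
Definition orthogonal_mx (d : nat) (Q : 'M[R]_d) : Prop := Q *m Q^T = 1%:M.

Definition tailc (d : nat) (c : 'rV[R]_d) : 'rV[R]_(d.-1) :=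
  \row_(k < d.-1) c 0 (widen_ord (leq_pred d) k).

Definition lastc (d : nat) (c : 'rV[R]_d) : R :=
  \sum_(k < d | val k == d.-1) c 0 k.

Definition C1fun (m : nat) (phi : 'rV[R]_m -> R) : Prop :=
  (forall z, differentiable phi z) /\
  forall j : 'I_m, continuous (fun z => derive phi z (delta_mx 0 j)).

Definition grad (m : nat) (phi : 'rV[R]_m -> R) (z : 'rV[R]_m) : 'rV[R]_m :=
  \row_(j < m) derive phi z (delta_mx 0 j).

Definition graph_chart (d : nat) (S : set 'rV[R]_d) (x : 'rV[R]_d)
  (Q : 'M[R]_d) (r : R) (phi : 'rV[R]_(d.-1) -> R) : Prop :=
  [/\ orthogonal_mx Q, 0 < r, C1fun phi, phi 0 = 0 &
      forall z, cball x r z ->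
        (S z <-> phi (tailc ((z - x) *m Q)) < lastc ((z - x) *m Q))].

Definition C1_boundary (d : nat) (S : set 'rV[R]_d) : Prop :=
  forall x, bd S x -> exists Q r phi, graph_chart S x Q r phi.

(* nv is the inward unit normal to S at x: in a graph chart, nv is the unit
   vector with coordinates proportional (with positive factor) to (-grad phi(0), 1). *)
Definition inward_normal (d : nat) (S : set 'rV[R]_d) (x nv : 'rV[R]_d) : Prop :=
  exists Q r phi, [/\ graph_chart S x Q r phi, enorm nv = 1,
    0 < lastc (nv *m Q) &
    tailc (nv *m Q) = - lastc (nv *m Q) *: grad phi 0].

Definition Dgeom (d I : nat) (G : set 'rV[R]_d) (Gi : 'I_I -> set 'rV[R]_d)
  (r : R) : \bar R :=
  if r == 0 then 0%E else
  ereal_sup ([set 0%E] `|`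
    [set e | exists (J : {set 'I_I}) (x : 'rV[R]_d), [/\ J != finset.set0,
       (forall j, j \in J -> Unbhd r (bd (Gi j) `&` bd G) x) &
       e = edist x [set z | forall j, j \in J -> (bd (Gi j) `&` bd G) z]]]).

Definition Dext (D : R -> \bar R) (v : \bar R) : \bar R :=
  match v with EFin r => D r | +oo%E => +oo%E | -oo%E => 0%E end.

Definition osc (k : nat) (w : R -> 'rV[R]_k) (s t : R) : \bar R :=
  ereal_sup [set e | exists s' t', [/\ s <= s', s' < t', t' <= t &
               e = (enorm (w t' - w s'))%:E]].

Definition cadlag (k : nat) (f : R -> 'rV[R]_k) (s t : R) : Prop :=
  (forall u, s <= u -> u < t -> f x @[x --> u^'+] --> f u) /\
  (forall u, s < u -> u <= t -> exists l : 'rV[R]_k, f x @[x --> u^'-] --> l).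

Definition llim (f : R -> R) (u : R) : R := lim (f x @[x --> u^'-]).

Definition vint (d : nat) (mu : {measure set R -> \bar R}) (s u : R)
  (g : R -> 'rV[R]_d) : 'rV[R]_d :=
  \row_(k < d) Rintegral mu `]s, u]%classic (fun v => g v 0 k).

End Defs.

(* Main.v *)
Require Import Defs.
From HB Require Import structures.
From mathcomp Require Import all_boot all_order all_algebra.
From mathcomp Require Import all_classical all_reals all_analysis.
From mathcomp Require Import measurable_realfun ring lra.
Import Order.TTheory GRing.Theory Num.Theory numFieldNormedType.Exports.
Set Implicit Arguments. Unset Strict Implicit. Unset Printing Implicit Defensive.
Local Open Scope classical_set_scope.
Local Open Scope ring_scope.

(** Write [F_j] for the part of the boundary of [G_j] lying on the boundary of [G],
    [Y] for the sum of the [y_i] and [eta = Osc(x) + delta].  One bounds the increments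
    of [Y] by induction on the number of faces that push, which also bounds those of
    [w], since [|w(v) - w(u)| <= Osc(x) + Y(v) - Y(u)].  Let [nu] be the bound when at
    most [k] faces push, [r = nu + O(eta)], and let [k + 1] faces be allowed to push.  If
    [w] is at distance more than [r] from some [F_j], then it can never come within
    [delta] of [F_j] afterwards, because until then only [k] faces push; so the
    inductive bound applies.  Otherwise stop at the first time when [w] is not within [r]
    of every active face: the inductive bound applies after it.  Before it, [w] is at any
    two times within about [D(r)] of points [z0], [z1] common to all active faces.  Every
    push has component at least [3a/4] along [n = \sum_i b_i(z1) n_i(z1)], whereas
    (A2) at [z1] bounds the component of [z1 - z0] along [n] by [(a/4) |z1 - z0|]; the
    difference in slopes bounds the increment of [Y] by [(8/a) (D(r) + eta)]. *)

(** * Inner product and Euclidean norm on row vectors *)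

Section Euclidean.
Variables (R : realType) (d : nat).
Implicit Types u v w : 'rV[R]_d.

Lemma dotpC u v : dotp u v = dotp v u.
Proof. by apply: eq_bigr => k _; rewrite mulrC. Qed.

Lemma dotpDl u v w : dotp (u + v) w = dotp u w + dotp v w.
Proof. by rewrite -big_split; apply: eq_bigr => k _; rewrite mxE mulrDl. Qed.

Lemma dotpDr u v w : dotp w (u + v) = dotp w u + dotp w v.
Proof. by rewrite dotpC dotpDl !(dotpC w). Qed.

Lemma dotpZl c u v : dotp (c *: u) v = c * dotp u v.
Proof. by rewrite mulr_sumr; apply: eq_bigr => k _; rewrite mxE mulrA. Qed.

Lemma dotpZr c u v : dotp u (c *: v) = c * dotp u v.
Proof. by rewrite dotpC dotpZl dotpC. Qed.

Lemma dotpNl u v : dotp (- u) v = - dotp u v.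
Proof. by rewrite -scaleN1r dotpZl mulN1r. Qed.

Lemma dotpNr u v : dotp u (- v) = - dotp u v.
Proof. by rewrite dotpC dotpNl dotpC. Qed.

Lemma dotp_suml (J : Type) (r : seq J) (P : pred J) (f : J -> 'rV[R]_d) v :
  dotp (\sum_(i <- r | P i) f i) v = \sum_(i <- r | P i) dotp (f i) v.
Proof.
by apply: (big_morph (fun z => dotp z v)) => [x y|];
  [exact: dotpDl | rewrite -(scale0r 0) dotpZl mul0r].
Qed.

Lemma dotp_sumr (J : Type) (r : seq J) (P : pred J) (f : J -> 'rV[R]_d) v :
  dotp v (\sum_(i <- r | P i) f i) = \sum_(i <- r | P i) dotp v (f i).
Proof. by rewrite dotpC dotp_suml; apply: eq_bigr => i _; rewrite dotpC. Qed.

Lemma dotpp u : dotp u u = enorm u ^+ 2.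
Proof.
rewrite /enorm sqr_sqrtr; first by apply: eq_bigr => k _; rewrite expr2.
by apply: sumr_ge0 => k _; rewrite sqr_ge0.
Qed.

Lemma enorm_ge0 u : 0 <= enorm u.
Proof. exact: sqrtr_ge0. Qed.

Lemma enormN u : enorm (- u) = enorm u.
Proof. by congr Num.sqrt; apply: eq_bigr => k _; rewrite mxE sqrrN. Qed.

Lemma enormB u v : enorm (u - v) = enorm (v - u).
Proof. by rewrite -enormN opprB. Qed.

Lemma enorm_eq0 u : enorm u = 0 -> u = 0.
Proof.
move=> u0; have : dotp u u = 0 by rewrite dotpp u0 expr0n.
rewrite /dotp => /eqP; rewrite psumr_eq0 => [/allP u00|k _]; last first.
  by rewrite -expr2 sqr_ge0.
apply/rowP => k; rewrite mxE; apply/eqP.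
by rewrite -sqrf_eq0 expr2; apply: u00; rewrite mem_index_enum.
Qed.

(** Cauchy-Schwarz: the squared norm of [enorm v *: u - enorm u *: v] is [2 * enorm u * enorm v]
    times the gap between the two sides. *)
Lemma dotp_le_enorm u v : dotp u v <= enorm u * enorm v.
Proof.
have [u0|u0] := eqVneq (enorm u) 0.
  by rewrite (enorm_eq0 u0) -(scale0r 0) dotpZl mul0r mulr_ge0 ?enorm_ge0.
have [v0|v0] := eqVneq (enorm v) 0.
  by rewrite (enorm_eq0 v0) -(scale0r 0) dotpZr mul0r mulr_ge0 ?enorm_ge0.
have up : 0 < enorm u by rewrite lt_neqAle eq_sym u0 enorm_ge0.
have vp : 0 < enorm v by rewrite lt_neqAle eq_sym v0 enorm_ge0.
have := sqr_ge0 (enorm (enorm v *: u - enorm u *: v)).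
rewrite -dotpp !(dotpDl, dotpDr, dotpNl, dotpNr, dotpZl, dotpZr) !dotpp.
rewrite (dotpC v u) => h; rewrite -subr_ge0 -(pmulr_rge0 _ (mulr_gt0 up vp)).
set p := dotp u v in h *; set A := enorm u in h *; set B := enorm v in h *.
have -> : A * B * (A * B - p) = 2^-1 *
   (B * (B * A ^+ 2) - B * (A * p) - (A * (B * p) - A * (A * B ^+ 2))) by lra.
by rewrite mulr_ge0 // (le_trans h) //; lra.
Qed.

Lemma dotp_ge_enorm u v : - (enorm u * enorm v) <= dotp u v.
Proof.
by rewrite lerNl -dotpNl (le_trans (dotp_le_enorm _ _)) // enormN.
Qed.

Lemma ler_enormD u v : enorm (u + v) <= enorm u + enorm v.
Proof.
rewrite -(@ler_pXn2r _ 2) ?nnegrE ?addr_ge0 ?enorm_ge0 //.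
rewrite -dotpp !(dotpDl, dotpDr) !dotpp (dotpC v u) sqrrD.
have := dotp_le_enorm u v; lra.
Qed.

Lemma ler_enormBD u v w : enorm (u - w) <= enorm (u - v) + enorm (v - w).
Proof. by rewrite (le_trans _ (ler_enormD _ _)) // addrA subrK. Qed.

Lemma enormZ c u : 0 <= c -> enorm (c *: u) = c * enorm u.
Proof.
move=> c0; apply/eqP.
rewrite -(@eqrXn2 _ 2) ?mulr_ge0 ?enorm_ge0 //.
by rewrite -dotpp dotpZl dotpZr dotpp exprMn mulrA expr2.
Qed.

Lemma ler_enorm_sum (J : Type) (r : seq J) (P : pred J) (f : J -> 'rV[R]_d) :
  enorm (\sum_(i <- r | P i) f i) <= \sum_(i <- r | P i) enorm (f i).
Proof.
elim/big_rec2: _ => [|i y1 y2 _ h].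
  by rewrite -(scale0r 0) enormZ // mul0r.
by rewrite (le_trans (ler_enormD _ _)) // lerD2l.
Qed.

Lemma ler_enorm_coord u k : `|u 0 k| <= enorm u.
Proof.
rewrite -sqrtr_sqr ler_sqrt; last by apply: sumr_ge0 => i _; exact: sqr_ge0.
by rewrite (bigD1 k) //= lerDl sumr_ge0 // => i _; exact: sqr_ge0.
Qed.

Lemma ler_enorm_sum_coord u : enorm u <= \sum_k `|u 0 k|.
Proof.
have hu : 0 <= \sum_k `|u 0 k| by exact: sumr_ge0.
rewrite -(@ler_pXn2r _ 2) ?nnegrE ?enorm_ge0 // -dotpp expr2 mulr_suml.
apply: ler_sum => k _; rewrite -expr2 -real_normK ?num_real // expr2 ler_wpM2l //.
by rewrite (bigD1 k) //= lerDl sumr_ge0.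
Qed.

End Euclidean.

(** * First exit from a condition along a nondecreasing function *)

Section Crossing.
Variable R : realType.

(* [v] and [v'] lie on either side of (or at) the first exit from [P], arbitrarily close to
   it; [K1] and [K2] bound the increments of [Y] just after and just before a time. *)
Lemma crossing (P : R -> Prop) (Y : R -> R) (K1 K2 u1 u2 : R) :
  0 <= K1 -> 0 <= K2 -> u1 <= u2 ->
  (forall p q, u1 <= p -> p <= q -> q <= u2 -> Y p <= Y q) ->
  (forall p, u1 <= p < u2 -> exists2 q, p < q <= u2 & Y q - Y p <= K1) ->
  (forall p, u1 < p <= u2 -> exists2 q, u1 <= q < p & Y p - Y q <= K2) ->
  P u1 ->
  exists v v', [/\ u1 <= v, v <= v', v' <= u2,
    (forall r, u1 <= r <= v -> P r) & (v' = u2 \/ ~ P v') /\ Y v' - Y v <= K1 + K2].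
Proof.
move=> K10 K20 u12 Ymono Yr Yl Pu1.
(* Times up to which [P] has held throughout; every earlier time also qualifies ([Slt]), so only the
   supremum is in doubt. *)
pose S := [set v | u1 <= v <= u2 /\ forall r, u1 <= r <= v -> P r].
have Su1 : S u1.
  by split=> [|r]; [rewrite lexx | move=> /andP[a b]; have -> : r = u1 by apply/le_anti/andP].
have ubS : ubound S u2 by move=> v [/andP[]].
have hS : has_sup S by split; [exists u1 | exists u2].
set sg := sup S.
have sg1 : u1 <= sg by apply: ub_le_sup => //; case: hS.
have sg2 : sg <= u2 by apply: ge_sup => //; case: hS.
have Slt v : u1 <= v -> v < sg -> S v.
  move=> u1v vs; have [q Sq vq] := @sup_gt _ S v (ex_intro _ u1 Su1) vs.
  split; first by rewrite u1v (le_trans (ltW vs)).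
  move=> r /andP[r1 r2]; apply: Sq.2; rewrite r1 /=; exact: le_trans r2 (ltW vq).
(* If the supremum is not attained, [Yl] gives a time of [S] just before it, at a cost of at most
   [K2]. *)
have [v [u1v vsg Sv Yv]] : exists v, [/\ u1 <= v, v <= sg, S v & Y sg - Y v <= K2].
  have [Ssg|nS] := pselect (S sg); first by exists sg; rewrite subrr; split.
  have u1s : u1 < sg by rewrite lt_neqAle sg1 andbT; apply/eqP => e; apply: nS; rewrite -e.
  have [|q /andP[q1 q2] Yq] := Yl sg; first by rewrite u1s.
  by exists q; split => //; [exact: ltW | exact: Slt].
have [[sgu|nP]|] := pselect (sg = u2 \/ ~ P sg).
- exists v, sg; split => //; first exact: Sv.2.
  by split; [left|rewrite ler_wpDl].
- exists v, sg; split => //; first exact: Sv.2.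
  by split; [right|rewrite ler_wpDl].
(* Now [P] holds at [sg < u2], so it fails after [sg] but no later than the [q] given by [Yr], at a
   cost of at most [K1]. *)
move=> /not_orP[/eqP sgu /contrapT Psg].
have sgu2 : sg < u2 by rewrite lt_neqAle sgu.
have [|q /andP[q1 q2] Yq] := Yr sg; first by rewrite sg1.
have nSq : ~ S q.
  move=> Sq; have : q <= sg by apply: ub_le_sup => //; case: hS.
  by rewrite leNgt q1.
have [r [r1 r2 nPr]] : exists r, [/\ sg < r, r <= q & ~ P r].
  apply: contrapT => h; apply: nSq; split.
    by rewrite q2 (le_trans sg1 (ltW q1)).
  move=> r /andP[u1r rq]; have [rs|sr|->//] := ltgtP r sg.
    by have [_] := Slt _ u1r rs; apply; rewrite u1r lexx.
  by apply: contrapT => nP; apply: h; exists r.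
exists v, r; split => //.
- exact: le_trans vsg (ltW r1).
- exact: le_trans r2 q2.
- exact: Sv.2.
split; first by right.
have := Ymono r q (le_trans sg1 (ltW r1)) r2 q2; lra.
Qed.

End Crossing.

(** * Right-continuous functions: measurability and composition *)

Section RightContinuous.
Variable R : realType.

(** The preimage of [B] is the union of the countably many sets [k <= c * v < k + 1] with [g k] in
    [B]. *)
Lemma measurable_comp_floor (g : int -> R) (c : R) :
  measurable_fun setT (fun v : R => g (Num.floor (c * v))).
Proof.
move=> _ B mB; rewrite setTI.
have -> : (fun v : R => g (Num.floor (c * v))) @^-1` B =
  \bigcup_(k : int) ([set v | B (g k)] `&` ( *%R c) @^-1` `[k%:~R, (k + 1)%:~R[).
  apply/seteqP; split => v /=.
    by move=> Bv; exists (Num.floor (c * v)) => //; split => //=; rewrite in_itv /= floor_itv.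
  by move=> [k _] [/= Bk]; rewrite in_itv /= => /floor_def ->.
apply: countable_bigcupT_measurable => [|k].
  exact: (@countableP int [set: int]).
have mk : measurable (( *%R c) @^-1` `[k%:~R, (k + 1)%:~R[ : set R).
  rewrite -[X in measurable X]setTI.
  exact: mulrl_measurable.
have [Bk|nBk] := pselect (B (g k)).
  by rewrite (_ : [set _ | _] = setT) ?setTI //; apply/seteqP; split.
by rewrite (_ : [set _ | _] = set0) ?set0I //; apply/seteqP; split.
Qed.

(* A right-continuous function is the pointwise limit of its values at the
   grid points [(floor (n.+1 * v) + 1) / n.+1], which decrease to [v]. *)
Lemma measurable_right_continuous (f : R -> R) (s t : R) :
  (forall v, s <= v -> v < t -> f x @[x --> v^'+] --> f v) ->
  measurable_fun `]s, t] f.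
Proof.
move=> fc.
(* Capping at [t] keeps the grid points in the interval; at [v = t] the sequence is constant. *)
pose h (n : nat) (v : R) : R := Num.min t ((Num.floor (n.+1%:R * v) + 1)%:~R / n.+1%:R).
apply: (@measurable_fun_cvg _ _ _ _ (fun n v => f (h n v))) => [n|v].
  have := @measurable_comp_floor (fun k => f (Num.min t ((k + 1)%:~R / n.+1%:R))) n.+1%:R.
  by apply: measurable_funS.
rewrite /= in_itv /= => /andP[sv vt].
have hb n : v < (Num.floor (n.+1%:R * v) + 1)%:~R / n.+1%:R <= v + n.+1%:R^-1.
  have n0 : (0 : R) < n.+1%:R by rewrite ltr0n.
  have := floor_itv (n.+1%:R * v) => /andP[f1 f2].
  rewrite ltr_pdivlMr // mulrC f2 /= ler_pdivrMr // mulrDl mulVf ?gt_eqF //.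
  by rewrite intrD lerD2r [v * _]mulrC.
have [vt'|vt'] := eqVneq v t; first rewrite vt' in hb *.
  have -> : (fun n => f (h n t)) = fun=> f t; last exact: cvg_cst.
  apply/funext => n; congr f; apply: min_l; apply: ltW.
  by have /andP[] := hb n.
have {vt'}vt : v < t by rewrite lt_neqAle vt'.
apply: (iffLR (cvg_at_rightP f v (f v)) (fc v (ltW sv) vt)); split => [n|].
  by rewrite lt_min vt; have /andP[] := hb n.
apply: (@squeeze_cvgr _ _ _ _ (fun=> v) (fun n => v + n.+1%:R^-1)).
- apply: nearW => n; have /andP[h1 h2] := hb n.
  by rewrite le_min (ltW vt) (ltW h1) /= ge_min h2 orbT.
- exact: cvg_cst.
- by rewrite -[X in _ --> X]addr0; apply: cvgD; [exact: cvg_cst|exact: cvg_harmonic].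
Qed.

(** Convergence of row vectors is coordinatewise, while [g] is Lipschitz for the Euclidean norm; the
    sum of the coordinate differences dominates that norm and tends to 0. *)
Lemma right_continuous_enorm (d : nat) (w : R -> 'rV[R]_d) (g : 'rV[R]_d -> R) (L v : R) :
  (forall z1 z2, `|g z1 - g z2| <= L * enorm (z1 - z2)) ->
  w x @[x --> v^'+] --> w v -> g (w x) @[x --> v^'+] --> g (w v).
Proof.
move=> gL wv.
have L0 : 0 <= `|L| by [].
have wk k : `|w v 0 k - w x 0 k| @[x --> v^'+] --> (0 : R).
  rewrite -(normr0 R) -(subrr (w v 0 k)).
  apply: cvg_norm; apply: cvgB; first exact: cvg_cst.
  exact: (cvg_comp _ _ wv (@coord_continuous R _ _ 0 k (w v))).
have ws (r : seq 'I_d) : \sum_(k <- r) `|w v 0 k - w x 0 k| @[x --> v^'+] --> (0 : R).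
  elim: r => [|k r IH].
    rewrite (_ : (fun _ => _) = fun=> 0); last by apply/funext => x; rewrite big_nil.
    exact: cvg_cst.
  rewrite (_ : (fun _ => _) = fun x => `|w v 0 k - w x 0 k| +
    \sum_(k <- r) `|w v 0 k - w x 0 k|); last by apply/funext => x; rewrite big_cons.
  have := cvgD (wk k) IH; rewrite addr0; exact.
have wL : `|L| * (\sum_k `|w v 0 k - w x 0 k|) @[x --> v^'+] --> (0 : R).
  by have := cvgM (@cvg_cst _ `|L| _ (v^'+) _) (ws (index_enum 'I_d)); rewrite mulr0; exact.
apply/cvgrPdist_le => e e0; move/cvgrPdist_le: wL => /(_ e e0).
apply: filterS => x; rewrite sub0r normrN ger0_norm; last first.
  by rewrite mulr_ge0 // sumr_ge0.
move=> h; rewrite (le_trans (gL _ _)) // (le_trans _ h) //.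
rewrite (le_trans (ler_wpM2r (enorm_ge0 _) (ler_norm L))) // ler_wpM2l //.
rewrite (le_trans (ler_enorm_sum_coord _)) // ler_sum // => k _.
by rewrite !mxE.
Qed.

End RightContinuous.

(** * Integrals of vector fields against a measure on the line *)

Section StieltjesIntegral.
Variables (R : realType) (mu : {measure set R -> \bar R}).

Lemma dotp_vint (d : nat) (g : R -> 'rV[R]_d) (n : 'rV[R]_d) (s t : R) :
  (forall k, mu.-integrable `]s, t] (fun v => (g v 0 k)%:E)) ->
  mu.-integrable `]s, t] (fun v => (dotp n (g v))%:E) /\
  dotp n (vint mu s t g) = Rintegral mu `]s, t] (fun v => dotp n (g v)).
Proof.
move=> ig.
have mI : measurable (`]s, t] : set R) by [].
have igz k : mu.-integrable `]s, t] (EFin \o (fun v => n 0 k * g v 0 k)).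
  rewrite (_ : _ \o _ = fun v => ((n 0 k)%:E * (g v 0 k)%:E)%E) //.
  exact: integrableZl.
(* Generalized to any list of coordinates for the induction. *)
suff : forall r : seq 'I_d,
    mu.-integrable `]s, t] (EFin \o (fun v => \sum_(k <- r) n 0 k * g v 0 k)) /\
    \sum_(k <- r) n 0 k * (vint mu s t g) 0 k =
    Rintegral mu `]s, t] (fun v => \sum_(k <- r) n 0 k * g v 0 k) by apply.
elim=> [|k r [IH1 IH2]].
  under [in X in _.-integrable _ X]eq_fun do rewrite big_nil.
  split; first exact: integrable0.
  rewrite big_nil; under eq_Rintegral do rewrite big_nil.
  by rewrite Rintegral_cst // mul0r.
have E : (fun v => \sum_(j <- k :: r) n 0 j * g v 0 j) =
  (fun v => n 0 k * g v 0 k + \sum_(j <- r) n 0 j * g v 0 j).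
  by apply/funext => v; rewrite big_cons.
rewrite E; split.
  exact: (integrableD mI (igz k) IH1).
rewrite RintegralD // big_cons IH2; congr (_ + _).
by rewrite mxE RintegralZl //; exact: ig.
Qed.

(** By additivity the difference is the integral over []u, v]], where the integrand paired with [n]
    is at least [c]; the bound [K] gives integrability. *)
Lemma vint_increment_ge (d : nat) (g : R -> 'rV[R]_d) (n : 'rV[R]_d) (s u v K m c : R) :
  s <= u -> u <= v -> (mu `]s, v]%classic < +oo)%E -> mu `]u, v]%classic = m%:E ->
  (forall k, measurable_fun `]s, v] (fun r => g r 0 k)) ->
  (forall k r, s < r <= v -> `|g r 0 k| <= K) ->
  (forall r, u < r <= v -> c <= dotp n (g r)) ->
  c * m <= dotp n (vint mu s v g - vint mu s u g).
Proof.
move=> su uv mufin mum mg gK cg.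
have ig k : mu.-integrable `]s, v] (EFin \o (fun r => g r 0 k)).
  apply: measurable_bounded_integrable => //.
  exists K; split; first exact: num_real.
  by move=> M KM r /=; rewrite in_itv /= => sr; rewrite (le_trans (gK k r sr)) // ltW.
have sub : `]s, u] `<=` (`]s, v] : set R).
  by move=> r /=; rewrite !in_itv /= => /andP[-> /le_trans]; apply.
have sub' : `]u, v] `<=` (`]s, v] : set R).
  by move=> r /=; rewrite !in_itv /= => /andP[/(le_lt_trans su) -> ].
have ig' k : mu.-integrable `]s, u] (fun r => (g r 0 k)%:E).
  by apply: (integrableS _ _ sub (ig k)).
have [i1 e1] := dotp_vint n ig; have [_ e2] := dotp_vint n ig'.
have E : `]s, v]%classic = `]s, u]%classic `|` `]u, v]%classic.
  by rewrite -itv_bndbnd_setU // bnd_simp.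
rewrite dotpDr dotpNr e1 e2 E Rintegral_setU //; last 2 first.
- by rewrite -E.
- apply/disj_setPS => r [] /=; rewrite !in_itv /= => /andP[_ ru] /andP[ur _].
  by move: ru; rewrite leNgt ur.
rewrite addrAC subrr add0r.
have -> : c * m = Rintegral mu `]u, v] (fun=> c) by rewrite Rintegral_cst // mum.
apply: le_Rintegral => //.
- apply: measurable_bounded_integrable => //; first by rewrite mum ltry.
  exists `|c|; split; first exact: num_real.
  by move=> M cM r _ /=; exact: ltW.
- exact: (integrableS _ _ sub' i1).
Qed.

(** Extended by zero outside their intervals, the two integrands coincide. *)
Lemma Rintegral_indic_stable (A : set R) (s u v : R) :
  u <= v -> (forall r, u < r <= v -> ~ A r) ->
  Rintegral mu `]s, v] (\1_A : R -> R) = Rintegral mu `]s, u] (\1_A : R -> R).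
Proof.
move=> uv nA; rewrite Rintegral_mkcond [RHS]Rintegral_mkcond; congr Rintegral.
apply/funext => r; rewrite /patch !mem_setE !in_itv /=.
have -> : (r <= v) = (r <= u) || (u < r <= v).
  by have [ru|ur] := leP r u; rewrite //= (le_trans ru uv).
have [/nA nAr|] := boolP (u < r <= v); last by rewrite orbF.
rewrite memNset //; have -> : point = 0 :> R by [].
by rewrite !if_same.
Qed.

End StieltjesIntegral.

(** * Neighborhoods of boundary pieces and the function [D] *)

Section Neighborhoods.
Variables (R : realType) (d : nat).
Implicit Types (S : set 'rV[R]_d) (x z : 'rV[R]_d) (r : R).

Lemma edist_lt S x (e : \bar R) : (Defs.edist x S < e)%E ->
  exists2 z, S z & ((enorm (x - z)%R)%:E < e)%E.
Proof. by move=> /ereal_inf_lt[_ [z Sz <-] ze]; exists z. Qed.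

(** The infimum defining the distance need not be attained, hence the strictly larger radius. *)
Lemma Unbhd_lt S x r r' : Unbhd r S x -> r < r' -> exists2 z, S z & enorm (x - z) < r'.
Proof.
move=> xr rr'; have [|z Sz] := @edist_lt S x r'%:E.
  by apply: (le_lt_trans xr); rewrite lte_fin.
by rewrite lte_fin; exists z.
Qed.

Lemma Unbhd_enorm S x z r : S z -> enorm (x - z) <= r -> Unbhd r S x.
Proof.
move=> Sz xz; rewrite /Unbhd /= (@le_trans _ _ (enorm (x - z))%:E) ?lee_fin //.
by apply: ereal_inf_lbound; exists z.
Qed.

Lemma Unbhd_le S x r r' : r <= r' -> Unbhd r S x -> Unbhd r' S x.
Proof. by move=> rr' /le_trans; apply; rewrite lee_fin. Qed.

Variables (I : nat) (G : set 'rV[R]_d) (Gi : 'I_I -> set 'rV[R]_d).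

Lemma Dgeom_ge0 r : (0 <= Dgeom G Gi r)%E.
Proof.
by rewrite /Dgeom; case: ifP => // _; apply: ereal_sup_ubound; left.
Qed.

Lemma Dgeom_le r r' : 0 < r -> r <= r' -> (Dgeom G Gi r <= Dgeom G Gi r')%E.
Proof.
move=> r0 rr'; rewrite /Dgeom !gt_eqF ?(lt_le_trans r0) //.
apply: ge_ereal_sup => _ [->|[J [x [J0 xJ ->]]]]; apply: ereal_sup_ubound; first by left.
by right; exists J, x; split => // j /xJ; exact: Unbhd_le.
Qed.

(** The distance from [x] to the common part of the faces is one of the terms of the supremum
    [D(r)]; an almost nearest point serves as [z]. *)
Lemma Dgeom_lt (J : {set 'I_I}) x r e : J != finset.set0 -> 0 < r ->
  (forall j, j \in J -> Unbhd r (bd (Gi j) `&` bd G) x) ->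
  (Dgeom G Gi r < e%:E)%E ->
  exists2 z, (forall j, j \in J -> (bd (Gi j) `&` bd G) z) & enorm (x - z) < e.
Proof.
move=> J0 r0 xJ De.
have [|z] := @edist_lt [set z | forall j, j \in J -> (bd (Gi j) `&` bd G) z] x e%:E.
  apply: le_lt_trans De; rewrite /Dgeom gt_eqF //.
  by apply: ereal_sup_ubound; right; exists J, x.
by rewrite lte_fin; exists z.
Qed.

End Neighborhoods.

(** * The recursive oscillation bound and its limit at 0 *)

Section Modulus.
Variable R : realType.
Implicit Types (D : R -> \bar R) (K c u : R).

(** Stated without the geometry, because [Pi] may depend only on [D], [a] and the number of
    faces. *)
Definition modulus D : Prop := [/\ (forall r, 0 < r -> (0 <= D r)%E),
  (forall r r', 0 < r -> r <= r' -> (D r <= D r')%E) &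
  (forall e, 0 < e -> exists eta, 0 < eta /\
     forall r, 0 < r -> r < eta -> (D r <= e%:E)%E)].

(* Oscillation bound when at most [k] of the constraints are active; it exceeds
   the bound on the total increment of [y] by the margin [K * u]. *)
Fixpoint oscbound D K c (k : nat) u : \bar R :=
  if k is k'.+1 then
    (c%:E * (Dext D (oscbound D K c k' u) + u%:E) + (K * u)%:E + oscbound D K c k' u)%E
  else (K * u)%:E.

Variables (D : R -> \bar R) (K c : R).
Hypotheses (Dmod : modulus D) (K0 : 0 < K) (c0 : 0 < c).

Lemma Dext_ge0 e : (0 < e)%E -> (0 <= Dext D e)%E.
Proof. by case: e => [r||] //; rewrite lte_fin; case: Dmod => + _ _; apply. Qed.

Lemma Dext_le e f : (0 < e)%E -> (e <= f)%E -> (Dext D e <= Dext D f)%E.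
Proof.
case: Dmod => _ Dle _.
by case: e f => [r||] [r'||] //=; rewrite ?leey // lte_fin lee_fin; exact: Dle.
Qed.

Lemma oscbound_gt0 k u : 0 < u -> (0 < oscbound D K c k u)%E.
Proof.
move=> u0; elim: k => [|k IH] /=; first by rewrite lte_fin mulr_gt0.
rewrite -[ltLHS]add0e lee_ltD // ?adde_ge0 ?lee_fin ?mulr_ge0 ?(ltW K0) ?(ltW u0) //.
by rewrite mule_ge0 ?lee_fin ?(ltW c0) // adde_ge0 ?Dext_ge0 // lee_fin ltW.
Qed.

Lemma oscbound_leS k u : 0 < u -> (oscbound D K c k u <= oscbound D K c k.+1 u)%E.
Proof.
move=> u0 /=; rewrite leeDr // adde_ge0 ?lee_fin ?mulr_ge0 ?(ltW K0) ?(ltW u0) //.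
rewrite mule_ge0 ?lee_fin ?(ltW c0) // adde_ge0 ?lee_fin ?(ltW u0) //.
by rewrite Dext_ge0 // oscbound_gt0.
Qed.

Lemma oscbound_le_index k m u : 0 < u -> (k <= m)%N ->
  (oscbound D K c k u <= oscbound D K c m u)%E.
Proof.
move=> u0; elim: m => [|m IH]; first by rewrite leqn0 => /eqP ->.
rewrite leq_eqVlt => /predU1P[-> //|]; rewrite ltnS => /IH /le_trans; apply.
exact: oscbound_leS.
Qed.

Lemma oscbound_le k u v : 0 < u -> u <= v -> (oscbound D K c k u <= oscbound D K c k v)%E.
Proof.
move=> u0 uv; elim: k => [|k IH] /=; first by rewrite lee_fin ler_pM2l.
rewrite leeD // leeD ?lee_fin ?ler_pM2l //.
rewrite lee_wpmul2l ?lee_fin ?(ltW c0) // leeD ?lee_fin //.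
by rewrite Dext_le // oscbound_gt0.
Qed.

Lemma oscbound_cvg0 k e : 0 < e -> exists eta, 0 < eta /\
  forall u, 0 < u -> u < eta -> (oscbound D K c k u <= e%:E)%E.
Proof.
elim: k e => [|k IH] e e0 /=.
  exists (e / K); split=> [|u u0]; first exact: divr_gt0.
  by rewrite ltr_pdivlMr // lee_fin mulrC => /ltW.
case: (Dmod) => _ _ /(_ (e / 4 / c)) []; first by rewrite !divr_gt0.
move=> eta1 [eta10 D1].
(* The bound [e] is split into quarters for [c * D r], [c * u], [K * u] and [r]; halving [eta1]
   makes [r < eta1] strict. *)
have [|eta2 [eta20 L2]] := IH (Num.min (eta1 / 2) (e / 4)).
  by rewrite lt_min !divr_gt0.
exists (Num.min eta2 (Num.min (e / 4 / c) (e / 4 / K))); split.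
  by rewrite !lt_min eta20 !divr_gt0.
move=> u u0; rewrite !lt_min => /and3P[u2 uc uK].
move: (L2 u u0 u2) (oscbound_gt0 k u0); case: (oscbound D K c k u) => [r||] //=.
rewrite !lee_fin lte_fin le_min => /andP[r1 r2] r0.
have := D1 r r0; case: Dmod => /(_ r r0) + _ _.
case: (D r) => [p||] //=; last by move=> _ /(_ ltac:(lra)).
move=> _ /(_ ltac:(lra)); rewrite !lee_fin => pe.
have : c * p <= e / 4 by rewrite mulrC -ler_pdivlMr.
have : c * u <= e / 4 by rewrite mulrC -ler_pdivlMr // ltW.
have : K * u <= e / 4 by rewrite mulrC -ler_pdivlMr // ltW.
lra.
Qed.

End Modulus.

(** * Induction on the number of pushing faces *)

Section Induction.
Variables (R : realType) (I d : nat) (F : 'I_I -> set 'rV[R]_d).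
Variables (w : R -> 'rV[R]_d) (y : R -> 'rV[R]_I) (D : R -> \bar R).
Variables (c K delta kappa th eta s t bound : R) (N : nat).

Let Y u := \sum_i y u 0 i.
Let bnd := oscbound D K c.

Hypotheses (Dmod : modulus D) (c0 : 0 < c) (K0 : 0 < K) (eta0 : 0 < eta) (delta0 : 0 < delta) (kappa0 : 0 <= kappa) (th0 : 0 <= th).
(** The margin pays for the driving path ([th]), for one crossing ([delta + kappa]) and for the
    distance to a point of a face ([2 * delta]). *)
Hypothesis Keta : th + (delta + kappa) + 2 * delta <= K * eta.
Hypothesis ymono : forall i u v, s <= u -> u <= v -> v <= t -> y u 0 i <= y v 0 i.
Hypothesis disp : forall u v, s <= u -> u <= v -> v <= t ->
  enorm (w v - w u) <= th + (Y v - Y u).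
Hypothesis Yright : forall p u, s <= p -> p < u -> u <= t ->
  exists2 q, p < q <= u & Y q - Y p <= delta.
Hypothesis Yleft : forall p u, s <= u -> u < p -> p <= t ->
  exists2 q, u <= q < p & Y p - Y q <= kappa.
Hypothesis idle : forall j u v, s <= u -> u <= v -> v <= t ->
  (forall r, u < r <= v -> ~ Unbhd delta (F j) (w r)) -> y v 0 j = y u 0 j.
(** The one place where the normal directions, through (A2) and (A5), enter the induction. *)
Hypothesis near : forall (J : {set 'I_I}) (u v r : R), J != finset.set0 ->
  s <= u -> u <= v -> v <= t -> (forall i, i \notin J -> y v 0 i = y u 0 i) ->
  0 < r -> (D r < bound%:E)%E ->
  (forall j, j \in J -> Unbhd r (F j) (w u)) ->
  (forall j, j \in J -> Unbhd r (F j) (w v)) ->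
  ((Y v - Y u)%:E <= c%:E * (D r + eta%:E))%E.
Hypothesis Dsmall : (Dext D (bnd N eta) < bound%:E)%E.

Let Ymono u v : s <= u -> u <= v -> v <= t -> Y u <= Y v.
Proof. by move=> su uv vt; apply: ler_sum => i _; exact: ymono. Qed.

Let y_const i u v p q : s <= u -> u <= p -> p <= q -> q <= v -> v <= t ->
  y v 0 i = y u 0 i -> y q 0 i = y p 0 i.
Proof.
move=> su up pq qv vt e; apply/le_anti/andP; split; last first.
  by apply: ymono => //; [exact: le_trans up | exact: le_trans vt].
have h1 : y u 0 i <= y p 0 i by apply: ymono => //; exact: le_trans (le_trans pq qv) vt.
have h2 : y q 0 i <= y v 0 i.
  by apply: ymono => //; exact: le_trans su (le_trans up pq).
by rewrite (le_trans h2) // e.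
Qed.

Let Ycross (P : R -> Prop) u v : s <= u -> u <= v -> v <= t -> P u ->
  exists p q, [/\ u <= p, p <= q, q <= v, (forall r, u <= r <= p -> P r) &
    (q = v \/ ~ P q) /\ Y q - Y p <= delta + kappa].
Proof.
move=> su uv vt Pu; apply: crossing => //; first exact: ltW.
- by move=> p q up pq qv; apply: Ymono => //; [exact: le_trans up|exact: le_trans vt].
- by move=> p /andP[up pv]; apply: Yright => //; exact: le_trans up.
- by move=> p /andP[up pv]; apply: Yleft => //; exact: le_trans vt.
Qed.

Lemma increment_le_oscbound k (J : {set 'I_I}) u v : (k <= N)%N -> (#|J| <= k)%N ->
  s <= u -> u <= v -> v <= t -> (forall i, i \notin J -> y v 0 i = y u 0 i) ->
  ((Y v - Y u + K * eta)%:E <= bnd k eta)%E.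
Proof.
elim: k J u v => [|k IH] J u v kN Jk su uv vt yJ.
  move: Jk; rewrite leqn0 cards_eq0 => /eqP J0.
  rewrite lee_fin -sumrB big1 ?add0r // => i _.
  by rewrite yJ ?subrr // J0 inE.
have leS := oscbound_leS Dmod K0 c0 k eta0.
have [Jk'|] := leqP #|J| k.
  by apply: le_trans leS; apply: IH Jk' su uv vt yJ; exact: ltnW.
move=> Jk'; have J0 : J != finset.set0 by rewrite -card_gt0 (leq_ltn_trans _ Jk').
have Dk : (Dext D (bnd k eta) < bound%:E)%E.
  apply: le_lt_trans Dsmall; apply: Dext_le => //; first exact: oscbound_gt0.
  by apply: oscbound_le_index => //; exact: ltnW.
have IHk := fun J p q h => IH J p q (ltnW kN) h.
(* The bound for [k] faces is finite: [Dext] sends [+oo] to [+oo], which [Dk] excludes. *)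
move: leS Dk IHk (oscbound_gt0 Dmod K0 c0 k eta0).
rewrite /bnd /=; case: (oscbound D K c k eta) => [r||] //= leS Dk IHk.
rewrite lte_fin => r0.
have {}IHk j p q : j \in J -> u <= p -> p <= q -> q <= v ->
    (forall m, p < m <= q -> ~ Unbhd delta (F j) (w m)) -> Y q - Y p + K * eta <= r.
  move=> jJ up pq qv nU; rewrite -lee_fin; apply: (IHk (J :\ j)) => //.
  - by move: Jk; rewrite (cardsD1 j) jJ.
  - exact: le_trans up.
  - exact: le_trans vt.
  move=> i; rewrite !inE negb_and negbK => /orP[/eqP ->|iJ].
    by apply: idle => //; [exact: le_trans up|exact: le_trans vt].
  by apply: (y_const (u := u) (v := v)) => //; exact: yJ.
(* The induction hypothesis on the degenerate interval at [u]. *)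
have rK : K * eta <= r.
  have /set0Pn[j jJ] := J0.
  have := IHk j u u jJ (lexx u) (lexx u) uv; rewrite subrr add0r; apply.
  by move=> m /andP[um]; rewrite leNgt um.
have [d0 t0 k0 Ke] : [/\ 0 < delta, 0 <= th, 0 <= kappa &
  th + (delta + kappa) + 2 * delta <= K * eta] by split.
have rd : delta <= r by lra.
(* Leaving the [r]-neighborhood of a face, [w] cannot come back within [delta]
   of it: on the way only the other faces push. *)
have escape j p q : j \in J -> u <= p -> p <= q -> q <= v ->
    ~ Unbhd r (F j) (w p) -> ~ Unbhd delta (F j) (w q).
  move=> jJ up pq qv nU Uq.
  have sp := le_trans su up; have qt := le_trans qv vt.
  have [|p' [q' [pp' pq' qq' nUp [Uq' YY]]]] :=
    Ycross (P := fun m => ~ Unbhd delta (F j) (w m)) sp pq qt.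
    by move=> /(Unbhd_le (r' := r)) -/(_ rd).
  have {}Uq' : Unbhd delta (F j) (w q') by case: Uq' => [->|/contrapT].
  have [|f Ff wf] := @Unbhd_lt _ _ _ _ _ (2 * delta) Uq'; first by lra.
  have YY' : Y p' - Y p + K * eta <= r.
    apply: (IHk j) => //; first exact: le_trans pq' (le_trans qq' qv).
    by move=> m /andP[/ltW h1 h2]; apply: nUp; rewrite h1.
  apply: nU; apply: (Unbhd_enorm Ff).
  apply: le_trans (ler_enormBD _ (w q') _) _.
  have := disp sp (le_trans pp' pq') (le_trans qq' qt).
  rewrite enormB; lra.
have E : ((Y v - Y u + K * eta)%:E <= c%:E * (D r + eta%:E) + (K * eta)%:E + r%:E)%E; last exact: E.
have Dr0 : (0 <= D r)%E by case: Dmod => /(_ r r0).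
have near' := near J0 su _ _ _ r0 Dk; case Er : (D r) Dk Dr0 near' => [Dr||] //=.
rewrite !lte_fin !lee_fin => Drb Dr0 near'.
have cD : 0 <= c * (Dr + eta) by rewrite mulr_ge0 ?addr_ge0 // ltW.
have [allU|] := pselect (forall j, j \in J -> Unbhd r (F j) (w u)); last first.
  move=> /existsNP[j /not_implyP[jJ nU]].
  have YY' : Y v - Y u + K * eta <= r.
    by apply: (IHk j) => // m /andP[/ltW h1 h2]; exact: (escape j u m).
  lra.
(* [near] bounds the increment up to [p], the crossing from [p] to [q] costs [delta + kappa], and if
   [q] is not the end then some face has been left there; the margin inside [r] pays for the
   crossing. *)
have [p [q [up pq qv Up [Uq YY]]]] :=
  Ycross (P := fun m => forall j, j \in J -> Unbhd r (F j) (w m)) su uv vt allU.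
have Yp : Y p - Y u <= c * (Dr + eta).
  rewrite -lee_fin EFinM; apply: near' => //.
  - exact: le_trans pq (le_trans qv vt).
  - by move=> i iJ; apply: (y_const (u := u) (v := v)) => //; [exact: le_trans qv|exact: yJ].
  - by apply: Up; rewrite up lexx.
case: Uq => [qv'|]; first by rewrite -qv'; lra.
move=> /existsNP[j /not_implyP[jJ nU]].
have YY' : Y v - Y q + K * eta <= r.
  apply: (IHk j) => //; first exact: le_trans up pq.
  move=> m /andP[/ltW h1 h2]; apply: (escape j q m) => //; exact: le_trans up pq.
lra.
Qed.

End Induction.

(** * Pairing the displacement with an averaged normal *)

Section Geometry.
Variables (R : realType) (I d : nat) (G : set 'rV[R]_d) (Gi : 'I_I -> set 'rV[R]_d).
Variables (n gam : 'I_I -> 'rV[R]_d -> 'rV[R]_d) (b : 'rV[R]_d -> 'I_I -> R).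
Variables (a L rho Ra : R).

(* Pairing the displacement with [n(z1) = \sum_i b_i(z1) n_i(z1)], where [z1] is a
   point of the intersection of the active faces close to [pv]: every push has
   component at least [3a/4] along [n(z1)], while by (A2) at [z1] the displacement
   has component at most [(a/4) |z1 - z0|] up to errors. *)
Lemma increment_le_near_faces (J : {set 'I_I}) (pu pv z0 z1 : 'rV[R]_d)
  (P : set 'rV[R]_d) (e th m : R) :
  0 < a < 1 -> 0 < L -> rho < a / (4 * L) / 4 -> rho < Ra / 4 ->
  (forall i z q, bd (Gi i) z -> bd G z -> closure G q -> enorm (z - q) < Ra ->
     - (a / 4 * enorm (z - q)) <= dotp (n i z) (q - z)) ->
  (forall i z, bd (Gi i) z -> enorm (n i z) = 1) ->
  (forall i z1 z2, enorm (gam i z1 - gam i z2) <= L * enorm (z1 - z2)) ->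
  (forall i, 0 <= b z1 i) -> \sum_(i < I | `[< bd (Gi i) z1 >]) b z1 i = 1 ->
  (forall j, bd (Gi j) z1 ->
     a <= dotp (\sum_(i < I | `[< bd (Gi i) z1 >]) b z1 i *: n i z1) (gam j z1)) ->
  bd G z0 -> bd G z1 -> (forall j, j \in J -> bd (Gi j) z1) ->
  (forall z, P z -> enorm (z - pv) <= 2 * rho) ->
  enorm (pu - z0) <= e -> enorm (pv - z1) <= e -> e <= rho / 2 -> 0 <= th ->
  enorm (pv - pu) <= th + m -> enorm (pv - pu) <= 2 * rho -> 0 <= rho ->
  (forall n0 kappa, enorm n0 <= 1 ->
     (forall j z, j \in J -> P z -> kappa <= dotp n0 (gam j z)) ->
     kappa * m <= dotp n0 (pv - pu) + th) ->
  m <= 8 / a * (e + th).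
Proof.
move=> /andP[a0 a1] L0 rhoL rhoR A2 n1 gamL b0 b1 ba Gz0 Gz1 Jz1 Pz puz pvz e_rho th0
  pm p2 rho0 push.
set nn := \sum_(i < I | `[< bd (Gi i) z1 >]) b z1 i *: n i z1 in ba.
have nn1 : enorm nn <= 1.
  apply: le_trans (ler_enorm_sum _ _ _) _; rewrite -[leRHS]b1.
  apply: ler_sum => i /asboolP Gz; rewrite enormZ // n1 // mulr1.
  exact: lexx.
have z10 : enorm (z1 - z0) <= 2 * e + enorm (pv - pu).
  apply: le_trans (ler_enormBD _ pv _) _.
  have := ler_enormBD pv pu z0; rewrite (enormB z1 pv); lra.
(* The distance is at most [3 * rho], while [4 * rho < Ra]. *)
have z10R : enorm (z1 - z0) < Ra by lra.
have nnz : dotp nn (z1 - z0) <= a / 4 * enorm (z1 - z0).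
  have -> : a / 4 * enorm (z1 - z0) =
      (\sum_(i < I | `[< bd (Gi i) z1 >]) b z1 i) * (a / 4 * enorm (z1 - z0)).
    by rewrite b1 mul1r.
  rewrite mulr_suml dotp_suml; apply: ler_sum => i /asboolP Gz.
  rewrite dotpZl ler_wpM2l //.
  have clz0 : closure G z0 by case: Gz0.
  have := A2 i z1 z0 Gz Gz1 clz0 z10R.
  by rewrite -(opprB z1 z0) dotpNr lerN2.
(* A position in [P] is within [2 * rho] of [pv], which is within [rho / 2] of [z1]: the directions
   vary by at most [a / 4], leaving [3 / 4 * a] of the slope [a]. *)
have rhoL' : L * (5 / 2 * rho) <= a / 4.
  have : rho * (16 * L) < a.
    rewrite -ltr_pdivlMr ?mulr_gt0 //; apply: lt_le_trans rhoL _.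
    rewrite -mulrA -invfM ler_wpM2l ?(ltW a0) // lef_pV2 ?posrE ?mulr_gt0 //; lra.
  lra.
have {}push := push nn (3 / 4 * a) nn1.
have {}push : 3 / 4 * a * m <= dotp nn (pv - pu) + th.
  apply: push => j z jJ Pzz.
  have -> : gam j z = gam j z1 + (gam j z - gam j z1) by rewrite addrC subrK.
  rewrite dotpDr.
  have h1 := ba j (Jz1 j jJ).
  have h2 := dotp_ge_enorm nn (gam j z - gam j z1).
  have h3 : enorm nn * enorm (gam j z - gam j z1) <= a / 4.
    apply: le_trans (ler_piMl (enorm_ge0 _) nn1) _.
    apply: le_trans (gamL _ _ _) _; apply: le_trans rhoL'.
    rewrite ler_pM2l //; apply: le_trans (ler_enormBD _ pv _) _.
    have := Pz z Pzz; lra.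
  lra.
have split_p : dotp nn (pv - pu) = dotp nn (pv - z1) + dotp nn (z1 - z0) + dotp nn (z0 - pu).
  by rewrite -!dotpDr; congr dotp; apply/rowP => k; rewrite !mxE; ring.
have le_e q : enorm q <= e -> dotp nn q <= e.
  move=> qe; apply: le_trans (dotp_le_enorm _ _) _; apply: le_trans qe.
  exact: ler_piMl (enorm_ge0 _) nn1.
have h1 := le_e _ pvz; have h2 : dotp nn (z0 - pu) <= e by apply: le_e; rewrite enormB.
have h3 : a * enorm (z1 - z0) <= a * (2 * e + th + m) by rewrite ler_pM2l //; lra.
have e0 : 0 <= e := le_trans (enorm_ge0 _) pvz.
(* The terms collect to [a / 2 * m <= 5 / 4 * (2 * e + th)], within the constant [8 / a]. *)
have h4 : a * (2 * e + th) <= 2 * e + th by apply: ler_piMl; [lra|exact: ltW].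
by rewrite mulrAC ler_pdivlMr //; lra.
Qed.

End Geometry.

(** * Increments of cadlag paths and of solutions of the constrained equation *)

Section Paths.
Variable R : realType.

Lemma osc_fin_bound (k : nat) (x : R -> 'rV[R]_k) (s t ox : R) :
  s < t -> osc x s t = ox%:E ->
  0 <= ox /\ (forall u v, s <= u -> u <= v -> v <= t -> enorm (x v - x u) <= ox).
Proof.
move=> st oE.
have h u v : s <= u -> u < v -> v <= t -> enorm (x v - x u) <= ox.
  move=> su uv vt; rewrite -lee_fin -oE; apply: ereal_sup_ubound.
  by exists u, v.
have o0 : 0 <= ox := le_trans (enorm_ge0 _) (h s t (lexx s) st (lexx t)).
split=> // u v su; rewrite le_eqVlt => /predU1P[-> _|]; last exact: h.
by rewrite subrr /enorm big1 ?sqrtr0 // => i _; rewrite mxE expr0n.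
Qed.

Lemma cadlag_coord_right (k : nat) (y : R -> 'rV[R]_k) (s t p u e : R) :
  cadlag y s t -> s <= p -> p < u -> u <= t -> 0 < e ->
  exists2 q, p < q <= u & forall i, `|y p 0 i - y q 0 i| <= e.
Proof.
move=> [yr _] sp pu ut e0.
have yp := yr p sp (lt_le_trans pu ut).
have H : \forall q \near p^'+, forall i, `|y p 0 i - y q 0 i| <= e.
  apply: filter_forall => i.
  have yi : y q 0 i @[q --> p^'+] --> y p 0 i.
    exact: (cvg_comp _ _ yp (@coord_continuous R _ _ 0 i (y p))).
  by move/cvgrPdist_le : yi => /(_ e e0).
have H2 : \forall q \near p^'+, p < q <= u.
  by move: (nbhs_right_gt p) (nbhs_right_le pu); apply: filterS2 => q -> ->.
have PF := at_right_proper_filter p.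
by have [q [h1 h2]] := @filter_ex R _ PF _ (@filterI R _ (@filter_filter _ _ PF) _ _ H H2); exists q.
Qed.

Lemma cadlag_coord_left (k : nat) (y : R -> 'rV[R]_k) (s t p u e : R) :
  cadlag y s t -> s <= u -> u < p -> p <= t -> 0 < e ->
  exists2 q, u <= q < p & forall i, `|llim (fun v => y v 0 i) p - y q 0 i| <= e.
Proof.
move=> [_ yl] su up pt e0.
have [l yp] := yl p (le_lt_trans su up) pt.
have H : \forall q \near p^'-, forall i, `|llim (fun v => y v 0 i) p - y q 0 i| <= e.
  apply: filter_forall => i.
  have yi : y q 0 i @[q --> p^'-] --> l 0 i.
    exact: (cvg_comp _ _ yp (@coord_continuous R _ _ 0 i l)).
  have -> : llim (fun v => y v 0 i) p = l 0 i by exact: cvg_lim yi.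
  by move/cvgrPdist_le : yi => /(_ e e0).
have H2 : \forall q \near p^'-, u <= q < p.
  by move: (nbhs_left_ge up) (nbhs_left_lt p); apply: filterS2 => q -> ->.
have PF := at_left_proper_filter p.
by have [q [h1 h2]] := @filter_ex R _ PF _ (@filterI R _ (@filter_filter _ _ PF) _ _ H H2); exists q.
Qed.

Variables (I d : nat) (gam : 'I_I -> 'rV[R]_d -> 'rV[R]_d) (L s t : R).
Variables (w x : R -> 'rV[R]_d) (y : R -> 'rV[R]_I) (mu : 'I_I -> {measure set R -> \bar R}).

(** The increment of [w - x] is a sum of integrals of the [gam i], bounded below face by face; the
    disjunction lets a face without push point anywhere. *)
Lemma skorokhod_increment_ge (n0 : 'rV[R]_d) (kappa : 'I_I -> R) (u v : R) :
  (forall i z1 z2, enorm (gam i z1 - gam i z2) <= L * enorm (z1 - z2)) ->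
  (forall i z, enorm (gam i z) = 1) ->
  cadlag w s t ->
  (forall i u v, s <= u -> u <= v -> v <= t -> mu i `]u, v]%classic = (y v 0 i - y u 0 i)%:E) ->
  (forall u, s <= u <= t ->
     w u = w s + x u - x s + \sum_(i < I) vint (mu i) s u (fun v => gam i (w v))) ->
  s <= u -> u <= v -> v <= t ->
  (forall i, y v 0 i = y u 0 i \/
     forall r, u < r <= v -> kappa i <= dotp n0 (gam i (w r))) ->
  \sum_(i < I) kappa i * (y v 0 i - y u 0 i) <= dotp n0 (w v - w u - (x v - x u)).
Proof.
move=> gamL gam1 [wr _] muE wE su uv vt kap.
have sv := le_trans su uv.
have -> : w v - w u - (x v - x u) =
    \sum_(i < I) (vint (mu i) s v (fun r => gam i (w r)) -
                  vint (mu i) s u (fun r => gam i (w r))).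
  rewrite sumrB (wE v) ?sv // (wE u) ?su ?(le_trans uv) //.
  apply/rowP => k; rewrite !mxE; ring.
rewrite dotp_sumr; apply: ler_sum => i _.
have main c : (forall r, u < r <= v -> c <= dotp n0 (gam i (w r))) ->
    c * (y v 0 i - y u 0 i) <= dotp n0 (vint (mu i) s v (fun r => gam i (w r)) -
                  vint (mu i) s u (fun r => gam i (w r))).
  move=> hc; apply: (@vint_increment_ge _ _ _ _ _ _ _ _ 1) => //.
  - by rewrite muE // ltry.
  - exact: muE.
  - move=> k; apply: measurable_right_continuous => r sr rv.
    apply: (@right_continuous_enorm _ _ w (fun z => gam i z 0 k) L).
      move=> z1 z2; apply: le_trans (gamL i z1 z2).
      by have := ler_enorm_coord (gam i z1 - gam i z2) k; rewrite !mxE.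
    by apply: wr => //; exact: lt_le_trans vt.
  - by move=> k r _; rewrite -(gam1 i (w r)) ler_enorm_coord.
have [yuv|] := kap i; last exact: main.
(* The increment of [y_i] being zero, any lower bound of the integrand serves; Cauchy-Schwarz gives
   [- enorm n0]. *)
have := main (- (enorm n0 * 1)); rewrite yuv subrr !mulr0; apply => r _.
by rewrite -(gam1 i (w r)) dotp_ge_enorm.
Qed.

(** Test the push part [V] against [- V]: unit directions have component at least [- enorm V] there,
    so [enorm V ^+ 2] is at most [enorm V] times the total push. *)
Lemma skorokhod_displacement (u v : R) :
  (forall i z1 z2, enorm (gam i z1 - gam i z2) <= L * enorm (z1 - z2)) ->
  (forall i z, enorm (gam i z) = 1) ->
  cadlag w s t ->
  (forall i u v, s <= u -> u <= v -> v <= t -> mu i `]u, v]%classic = (y v 0 i - y u 0 i)%:E) ->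
  (forall u, s <= u <= t ->
     w u = w s + x u - x s + \sum_(i < I) vint (mu i) s u (fun v => gam i (w v))) ->
  (forall i u v, s <= u -> u <= v -> v <= t -> y u 0 i <= y v 0 i) ->
  s <= u -> u <= v -> v <= t ->
  enorm (w v - w u) <= enorm (x v - x u) + \sum_(i < I) (y v 0 i - y u 0 i).
Proof.
move=> gamL gam1 wc muE wE ymono su uv vt.
set V := w v - w u - (x v - x u).
have VY : enorm V <= \sum_(i < I) (y v 0 i - y u 0 i).
  have : \sum_(i < I) - enorm V * (y v 0 i - y u 0 i) <= dotp (- V) V.
    apply: (skorokhod_increment_ge (kappa := fun=> - enorm V) gamL gam1 wc muE wE su uv vt) => i.
    by right => r _; have := dotp_ge_enorm (- V) (gam i (w r)); rewrite gam1 mulr1 enormN.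
  rewrite dotpNl dotpp -mulr_sumr mulNr lerN2 expr2.
  have [V0 _|V0] := eqVneq (enorm V) 0.
    by rewrite V0; apply: sumr_ge0 => i _; rewrite subr_ge0 ymono.
  by rewrite ler_pM2l // lt_neqAle eq_sym V0 enorm_ge0.
have -> : w v - w u = (x v - x u) + V by apply/rowP => k; rewrite !mxE; ring.
by apply: le_trans (ler_enormD _ _) _; rewrite lerD2l.
Qed.

End Paths.

(** * Assembling the bound from (A1)-(A5) *)

Lemma modulus_Dgeom (R : realType) (I d : nat) (G : set 'rV[R]_d)
  (Gi : 'I_I -> set 'rV[R]_d) (D : R -> \bar R) :
  (forall r, 0 < r -> Dgeom G Gi r = D r) ->
  (forall e, 0 < e -> exists eta, 0 < eta /\
     forall r, 0 < r -> r < eta -> (Dgeom G Gi r <= e%:E)%E) ->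
  modulus D.
Proof.
move=> DE Dlim; split => [r r0|r r' r0 rr'|e /Dlim[eta [eta0 De]]].
- by rewrite -DE // Dgeom_ge0.
- by rewrite -!DE // ?Dgeom_le // (lt_le_trans r0).
- by exists eta; split=> // r r0 re; rewrite -DE // De.
Qed.

Theorem theorem4p1 (R : realType) (I : nat) (a : R) (Dfun : R -> \bar R) :
  (0 < I)%N -> 0 < a < 1 ->
  exists Pi : R -> \bar R,
  [/\ (forall u v, 0 < u -> u <= v -> (Pi u <= Pi v)%E),
      (forall u, 0 < u -> (0 < Pi u)%E),
      (forall e, 0 < e -> exists eta, 0 < eta /\
          forall u, 0 < u -> u < eta -> (Pi u <= e%:E)%E) &
  forall (d : nat) (G : set 'rV[R]_d) (Gi : 'I_I -> set 'rV[R]_d)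
    (n gam : 'I_I -> 'rV[R]_d -> 'rV[R]_d) (L : R) (Rf : R -> R),
  (* (A1) *)
  G !=set0 -> domain G -> G = [set z | forall i, Gi i z] ->
  (forall i, [/\ Gi i !=set0, domain (Gi i), Gi i <> setT, C1_boundary (Gi i) &
      forall z, bd (Gi i) z -> inward_normal (Gi i) z (n i z)]) ->
  (* (A2) *)
  (forall eps, 0 < eps < 1 -> 0 < Rf eps /\
     forall i z y, bd (Gi i) z -> bd G z -> closure G y -> enorm (z - y) < Rf eps ->
       - (eps * enorm (z - y)) <= dotp (n i z) (y - z)) ->
  (* (A3), D(.) coincides with Dfun on (0,oo) *)
  (forall r, 0 < r -> Dgeom G Gi r = Dfun r) ->
  (forall e, 0 < e -> exists eta, 0 < eta /\
      forall r, 0 < r -> r < eta -> (Dgeom G Gi r <= e%:E)%E) ->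
  (* (A4) *)
  0 < L ->
  (forall i z1 z2, enorm (gam i z1 - gam i z2) <= L * enorm (z1 - z2)) ->
  (forall i z, enorm (gam i z) = 1) ->
  (* (A5) *)
  (exists b c : 'rV[R]_d -> 'I_I -> R, forall z, bd G z ->
     [/\ (forall i, 0 <= b z i) /\ (forall i, 0 <= c z i),
         \sum_(i < I | `[< bd (Gi i) z >]) b z i = 1,
         \sum_(i < I | `[< bd (Gi i) z >]) c z i = 1,
         (forall j, bd (Gi j) z ->
            a <= dotp (\sum_(i < I | `[< bd (Gi i) z >]) b z i *: n i z) (gam j z)) &
         (forall j, bd (Gi j) z ->
            a <= dotp (\sum_(i < I | `[< bd (Gi i) z >]) c z i *: gam i z) (n j z))]) ->
  forall (rho delta s t : R) (w x : R -> 'rV[R]_d) (y : R -> 'rV[R]_I)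
    (mu : 'I_I -> {measure set R -> \bar R}),
  0 < rho -> rho < Num.min (a / (4 * L) / 4) (Rf (a / 4) / 4) ->
  0 < delta -> delta < rho / 2 -> 0 <= s -> s < t ->
  cadlag w s t -> cadlag x s t -> cadlag y s t ->
  (* mu i is the Lebesgue-Stieltjes measure dy_i on (s,t] *)
  (forall i u v, s <= u -> u <= v -> v <= t -> mu i `]u, v]%classic = (y v 0 i - y u 0 i)%:E) ->
  (* (i) *)
  (exists x0, closure G x0 /\
     forall u, s <= u <= t -> (cball x0 rho `&` Unbhd delta G) (w u)) ->
  (* (ii) *)
  (forall u, s <= u <= t ->
     w u = w s + x u - x s + \sum_(i < I) vint (mu i) s u (fun v => gam i (w v))) ->
  (* (iii) *)
  (forall i, [/\ 0 <= y s 0 i,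
     (forall u v, s <= u -> u <= v -> v <= t -> y u 0 i <= y v 0 i),
     (forall u, s < u <= t -> y u 0 i - llim (fun v => y v 0 i) u <= delta) &
     (forall u, s <= u <= t -> y u 0 i = y s 0 i +
        Rintegral (mu i) `]s, u]%classic
          (\1_[set v | Unbhd delta (bd (Gi i) `&` bd G) (w v)] : R -> R))]) ->
  forall ox : R, osc x s t = ox%:E ->
  (* (iv) *)
  (Dext Dfun (Pi (ox + delta)%R) < (rho / 2)%:E)%E ->
  (osc w s t <= Pi (ox + delta)%R)%E /\ (osc y s t <= Pi (ox + delta)%R)%E].

Proof.
move=> I0 a01; have /andP[a0 a1] := a01.
(* [Pi] is chosen before the geometry. If [Dfun] is not a modulus, no geometry satisfying (A3) has
   it as its function, and any admissible [Pi] will do. *)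
have [Dmod|nDmod] := pselect (modulus Dfun); last first.
  exists (fun u => u%:E); split => [u v _ uv|u u0|e e0|].
  - by rewrite lee_fin.
  - by rewrite lte_fin.
  - by exists e; split=> // u _ /ltW; rewrite lee_fin.
  move=> d G Gi n gam L Rf _ _ _ _ _ DE Dlim.
  by case: nDmod; exact: modulus_Dgeom DE Dlim.
(* The margin must cover [ox + (2 * I + 3) * delta]: a crossing costs [(2 * I + 1) * delta], the
   distance to a face [2 * delta]. *)
pose K : R := (2 * I + 5)%:R.
have K0 : 0 < K by rewrite ltr0n addn_gt0 orbT.
have c0 : 0 < 8 / a by rewrite divr_gt0.
exists (oscbound Dfun K (8 / a) I); split.
- by move=> u v u0 uv; exact: oscbound_le.
- by move=> u u0; exact: oscbound_gt0.
- by move=> e e0; exact: oscbound_cvg0.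
move=> d G Gi n gam L Rf _ _ _ HGi A2 DE _ L0 gamL gam1 [b [c A5]].
move=> rho delta s t w x y mu rho0 rholt delta0 delta_rho s0 st wc xc yc muE.
move=> [x0 [_ wx0]] wE Hy ox oE Dsmall.
have [ox0 oxB] := osc_fin_bound st oE.
have [rhoL rhoR] : rho < a / (4 * L) / 4 /\ rho < Rf (a / 4) / 4.
  by move: rholt; rewrite lt_min => /andP.
have eta0 : 0 < ox + delta by rewrite ltr_wpDl.
have ymono i u v : s <= u -> u <= v -> v <= t -> y u 0 i <= y v 0 i.
  by case: (Hy i) => _ + _ _; apply.
pose Y u := \sum_i y u 0 i.
have disp u v : s <= u -> u <= v -> v <= t -> enorm (w v - w u) <= ox + (Y v - Y u).
  move=> su uv vt.
  apply: le_trans (skorokhod_displacement gamL gam1 wc muE wE ymono su uv vt) _.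
  by rewrite sumrB lerD2r oxB.
have normal1 i z : bd (Gi i) z -> enorm (n i z) = 1.
  by case: (HGi i) => _ _ _ _ h /h[Q [r [phi []]]].
have I0' : 0 < I%:R :> R by rewrite ltr0n.
have Yright p u : s <= p -> p < u -> u <= t -> exists2 q, p < q <= u & Y q - Y p <= delta.
  move=> sp pu ut.
  have [|q pqu yq] := cadlag_coord_right yc sp pu ut (e := delta / I%:R).
    by rewrite divr_gt0.
  exists q => //; rewrite -sumrB.
  have -> : delta = \sum_(i < I) delta / I%:R.
    by rewrite sumr_const card_ord -[RHS]mulr_natr divfK // gt_eqF.
  apply: ler_sum => i _; apply: le_trans (yq i).
  by rewrite distrC ler_norm.
(* Each of the [I] coordinates jumps by at most [delta], and its left limit is approached within a
   further [delta]. *)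
have Yleft p u : s <= u -> u < p -> p <= t ->
    exists2 q, u <= q < p & Y p - Y q <= I%:R * (2 * delta).
  move=> su up pt.
  have [q uqp yq] := cadlag_coord_left yc su up pt delta0.
  exists q => //; rewrite -sumrB.
  have -> : I%:R * (2 * delta) = \sum_(i < I) 2 * delta.
    by rewrite sumr_const card_ord mulr_natl.
  apply: ler_sum => i _; case: (Hy i) => _ _ jump _.
  have := jump p; rewrite (le_lt_trans su up) pt => /(_ isT).
  have := ler_norm (llim (fun v => y v 0 i) p - y q 0 i); have := yq i; lra.
have idle j u v : s <= u -> u <= v -> v <= t ->
    (forall r, u < r <= v -> ~ Unbhd delta (bd (Gi j) `&` bd G) (w r)) ->
    y v 0 j = y u 0 j.
  move=> su uv vt nU; case: (Hy j) => _ _ _ yE.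
  rewrite yE ?(le_trans su uv) // (yE u) ?su ?(le_trans uv) //.
  by congr (_ + _); exact: Rintegral_indic_stable.
have near (J : {set 'I_I}) (u v r : R) : J != finset.set0 ->
    s <= u -> u <= v -> v <= t -> (forall i, i \notin J -> y v 0 i = y u 0 i) ->
    0 < r -> (Dfun r < (rho / 2)%:E)%E ->
    (forall j, j \in J -> Unbhd r (bd (Gi j) `&` bd G) (w u)) ->
    (forall j, j \in J -> Unbhd r (bd (Gi j) `&` bd G) (w v)) ->
    ((Y v - Y u)%:E <= (8 / a)%:E * (Dfun r + (ox + delta)%:E))%E.
  move=> J0 su uv vt yJ r0 Dr Uu Uv; have sv := le_trans su uv.
  have Dr0 : (0 <= Dfun r)%E by case: Dmod => /(_ r r0).
  case Er : (Dfun r) Dr Dr0 => [D0||] //; rewrite lte_fin lee_fin => Drho D00.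
  (* Any [e > D0] yields common boundary points within [e]; the first term gives the estimate, and
     the cap [rho / 2], itself above [D0], keeps these points close enough for (A2) and (A4). *)
  pose e := Num.min (D0 + delta) (rho / 2).
  have De : (Dgeom G Gi r < e%:E)%E.
    by rewrite DE // Er lte_fin lt_min Drho andbT ltrDl.
  have [z0 z0J wz0] := Dgeom_lt J0 r0 Uu De.
  have [z1 z1J wz1] := Dgeom_lt J0 r0 Uv De.
  have [j0 j0J] := set0Pn _ J0.
  have [_ Gz0] := z0J j0 j0J; have [_ Gz1] := z1J j0 j0J.
  have [[b0 _] b1 _ ba _] := A5 z1 Gz1.
  have a4 : 0 < a / 4 < 1 by apply/andP; split; lra.
  have w2 p q : s <= p <= t -> s <= q <= t -> enorm (w p - w q) <= 2 * rho.
    move=> /wx0[hp _] /wx0[hq _]; apply: le_trans (ler_enormBD _ x0 _) _.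
    by move: hp hq; rewrite /cball /= (enormB x0); lra.
  have sut : s <= u <= t by rewrite su (le_trans uv).
  have svt : s <= v <= t by rewrite sv.
  have m_le : Y v - Y u <= 8 / a * (e + ox).
    apply: (@increment_le_near_faces _ _ _ G Gi n gam b a L rho (Rf (a / 4)) J
      (w u) (w v) z0 z1 [set z | exists2 p, u < p <= v & z = w p]) => //.
    - by case: (A2 _ a4).
    - by move=> j /z1J[].
    - move=> _ [p /andP[up pv] ->]; apply: w2 => //.
      by rewrite (le_trans su (ltW up)) (le_trans pv).
    - exact: ltW.
    - exact: ltW.
    - by rewrite /e ge_min lexx orbT.
    - exact: disp.
    - exact: w2.
    - exact: ltW.
    move=> n0 kappa n01 kap.
    have : \sum_(i < I) kappa * (y v 0 i - y u 0 i) <= dotp n0 (w v - w u - (x v - x u)).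
      apply: (skorokhod_increment_ge (kappa := fun=> kappa) gamL gam1 wc muE wE su uv vt) => i.
      have [iJ|iJ] := boolP (i \in J); last by left; exact: yJ.
      by right => p up; apply: kap => //; exists p.
    rewrite -mulr_sumr sumrB dotpDr dotpNr -/(Y v) -/(Y u) => h.
    have := dotp_ge_enorm n0 (x v - x u).
    have := le_trans (ler_piMl (enorm_ge0 _) n01) (oxB u v su uv vt).
    lra.
  rewrite -EFinD -EFinM lee_fin; apply: le_trans m_le _.
  rewrite ler_pM2l //; have : e <= D0 + delta by rewrite ge_min lexx.
  lra.
have Keta : ox + (delta + I%:R * (2 * delta)) + 2 * delta <= K * (ox + delta).
  rewrite /K natrD natrM; have := mulr_ge0 (ltW I0') ox0; lra.
have bound u v : s <= u -> u <= v -> v <= t ->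
    ((Y v - Y u + K * (ox + delta))%:E <= oscbound Dfun K (8 / a) I (ox + delta))%E.
  move=> su uv vt.
  apply: (@increment_le_oscbound _ _ _ (fun j => bd (Gi j) `&` bd G) w y Dfun (8 / a) K delta
    (I%:R * (2 * delta)) ox (ox + delta) s t (rho / 2) I _ _ _ _ _ _ _ _ _ _ _ _ _ _ _ I
    finset.setT) => //.
  - by rewrite !mulr_ge0 // ltW.
  - by rewrite cardsT card_ord.
  - by move=> i; rewrite inE.
have Idelta : 0 <= I%:R * (2 * delta) by rewrite !mulr_ge0 // ltW.
(* The margin in [bound] absorbs the part [ox] of the displacement of [w]; for [y], the increment of
   [Y] is the sum of the nonnegative coordinate increments. *)
split; apply: ge_ereal_sup => _ [u [v [su uv vt ->]]];
  apply: le_trans (bound u v su (ltW uv) vt); rewrite lee_fin.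
  have := disp u v su (ltW uv) vt; lra.
apply: le_trans (ler_enorm_sum_coord _) _.
rewrite (eq_bigr (fun i => y v 0 i - y u 0 i)) => [|i _]; last first.
  by rewrite !mxE ger0_norm // subr_ge0 ymono // ltW.
rewrite sumrB -/(Y v) -/(Y u); have := mulr_gt0 K0 eta0; lra.
Qed.
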